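(* Let $0<\lambda<1$ and $a>1-\lambda$, and let $f$ be the map of the cylinder $\mathbb{S}^1\times\mathbb{R}$, $\mathbb{S}^1=\mathbb{R}/2\mathbb{Z}$, given by $$f(x,y)=\big(x+y+g(x)\ (\mathrm{mod}\ 2),\ \lambda(y+g(x))\big),$$ where $g$ is the $2$-periodic sawtooth function $g(x)=a(x-1)$ for $x\in[0,2)$. Then $f$ has a singular hyperbolic attractor consisting of three components: an oscillating component $\mathcal{A}_o\subset P$, a rotating component $\mathcal{A}_r\subset R\setminus P$, and a component rotating with oscillations $\mathcal{A}_{ro}\subset R$. Here $R$ is the annulus $\{(x,y): x\in\mathbb{S}^1,\ |y|<\frac{a}{1-\lambda}\}$ and $P$ is the parallelogram defined in the context.
   Context: Off the discontinuity line $\{x\equiv0\ (\mathrm{mod}\ 2)\}$ the linearization of $f$ is the constant matrix $A=\begin{pmatrix}1+a&1\\ \lambda a&\lambda\end{pmatrix}$, with eigenvalues $\mu_1>1$, $0<\mu_2<1$ and eigenvectors $(1,\alpha_1)$, $(1,\alpha_2)$, where $$\alpha_{1,2}=\tfrac12\Big(-1-a+\lambda\pm\sqrt{(1+a+\lambda)^2-4\lambda}\Big).$$ Parallelogram $P$: work in the strip $-1\le x\le 1$ (a fundamental period, whose edges $x=\pm1$ are identified on the cylinder). Let $O_1=(-1,0)$ and $O_2=(1,0)$ (the same fixed saddle point on the cylinder). Let $M_2$ be the intersection point of the line $y=\alpha_1(x+1)$ (unstable direction through $O_1$) with the line $y=\alpha_2(x-1)$ (stable direction through $O_2$), and let $\bar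 M_2=-M_2$. Then $P=O_1M_2O_2\bar M_2$ is the closed parallelogram with these vertices, regarded as a subset of the cylinder. Attractor: $\mathcal{A}=\bigcap_{k\ge1}f^k(R)$, where $f(R)\subset R$. It is singular hyperbolic: off the discontinuity line the dynamics is uniformly hyperbolic, with $A$ expanding by $\mu_1$ along direction $(1,\alpha_1)$ and contracting by $\mu_2$ along $(1,\alpha_2)$; ''singular'' refers to the presence of the discontinuity line. Components: ''oscillating'' means consisting of points of $\mathcal{A}$ whose whole orbit stays in $P$; ''rotating'' means consisting of points of $\mathcal{A}$ whose whole orbit stays in $R\setminus P$, the orbits winding around the cylinder; ''rotating with oscillations'' means consisting of points of $\mathcal{A}$ whose orbits visit both $P$ and $R\setminus P$. *)

(* Defs.v *)
From HB Require Import structures.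
From mathcomp Require Import all_boot all_order all_algebra.
From mathcomp Require Import all_classical all_reals all_analysis.
From mathcomp Require Import ring lra.

Set Implicit Arguments.
Unset Strict Implicit.
Unset Printing Implicit Defensive.

Import Order.TTheory GRing.Theory Num.Theory.
Import numFieldNormedType.Exports.

Local Open Scope classical_set_scope.
Local Open Scope ring_scope.
Local Open Scope quotient_scope.

Definition circle_rel (R : realType) : rel R :=
  fun x y => (x - y) / 2 \is a Num.int.

Lemma circle_rel_equiv (R : realType) : equiv_class_of (@circle_rel R).
Proof.
split=> [x|x y|y x z]; rewrite /circle_rel.
- by rewrite subrr mul0r.
- by rewrite -[y - x]opprB mulNr rpredN.
- move=> xy yz; have -> : (x - z) / 2 = (x - y) / 2 + (y - z) / 2 by ring.
  exact: rpredD.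
Qed.

Canonical circle_equiv (R : realType) : equiv_rel R :=
  EquivRelPack (circle_rel_equiv R).

Definition circle (R : realType) : Type :=
  quotient_topology {eq_quot (circle_equiv R)}.
HB.instance Definition _ (R : realType) := Topological.on (circle R).
HB.instance Definition _ (R : realType) := Quotient.on (circle R).

Definition circle_of (R : realType) (x : R) : circle R := \pi_(circle R) x.

Lemma circle_ofP (R : realType) (x y : R) :
  circle_of x = circle_of y <-> (x - y) / 2 \is a Num.int.
Proof.
change (\pi_({eq_quot (circle_equiv R)}) x = \pi_({eq_quot (circle_equiv R)}) y
  <-> circle_rel x y).
by split=> [/eqmodP|h]; last exact/eqmodP.
Qed.

Definition cylinder (R : realType) : Type := (circle R * R)%type.
HB.instance Definition _ (R : realType) := Topological.on (cylinder R).

(* The universal covering of the cylinder by the plane. *)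
Definition cyl (R : realType) (z : R * R) : cylinder R := (circle_of z.1, z.2).

(* Since 2 * floor (x / 2) is the multiple of 2 such that x minus it lies in
   [0, 2), this is the 2-periodic extension of x |-> a (x - 1) on [0, 2). *)
Definition sawtooth (R : realType) (a x : R) : R :=
  a * (x - 2 * (Num.floor (x / 2))%:~R - 1).

Lemma sawtoothE (R : realType) (a x : R) :
  0 <= x < 2 -> sawtooth a x = a * (x - 1).
Proof.
move=> /andP[x0 x2]; rewrite /sawtooth (_ : Num.floor (x / 2) = 0).
  by rewrite mulr0 subr0.
by apply: floor_def; rewrite add0r /=; apply/andP; split; lra.
Qed.

Lemma sawtooth_periodic (R : realType) (a x y : R) :
  (x - y) / 2 \is a Num.int -> sawtooth a x = sawtooth a y.
Proof.
move=> /intrP[n hn]; rewrite /sawtooth.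
have -> : x / 2 = y / 2 + n%:~R by rewrite -hn; ring.
rewrite floorDrz ?intr_int // intrKfloor intrD.
have -> : x = y + 2 * n%:~R by rewrite -hn; field.
by congr (_ * _); ring.
Qed.

(* The lift of the map to the plane, with the horizontal displacement
   y + g(x) not reduced modulo 2. *)
Definition lift_map (R : realType) (lam a : R) (z : R * R) : R * R :=
  (z.1 + z.2 + sawtooth a z.1, lam * (z.2 + sawtooth a z.1)).

Definition cylmap (R : realType) (lam a : R) (p : cylinder R) : cylinder R :=
  cyl (lift_map lam a (repr p.1, p.2)).

Lemma cylmapE (R : realType) (lam a : R) (z : R * R) :
  cylmap lam a (cyl z) = cyl (lift_map lam a z).
Proof.
case: z => x y; rewrite /cylmap /cyl /lift_map /=.
have hr : (repr (circle_of x) - x) / 2 \is a Num.int.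
  by apply/circle_ofP; rewrite /circle_of reprK.
rewrite (sawtooth_periodic a hr); congr pair; apply/circle_ofP.
by rewrite (_ : _ / 2 = (repr (circle_of x) - x) / 2) //; ring.
Qed.

(* The full (two-sided) orbit of p, provided that f is bijective, which is the
   case of [cylmap] by [cylmap_bij] below. *)
Definition full_orbit (T : Type) (f : T -> T) (p : T) : set T :=
  [set q | exists n : nat, q = iter n f p \/ p = iter n f q].

Lemma cyl_surj (R : realType) (p : cylinder R) : exists z, p = cyl z.
Proof.
by exists (repr p.1, p.2); case: p => c y; rewrite /cyl /circle_of /= reprK.
Qed.

Lemma cylmap_bij (R : realType) (lam a : R) :
  lam != 0 -> bijective (cylmap lam a).
Proof.
move=> l0.
pose h (p : cylinder R) : cylinder R :=
  let x := repr p.1 - p.2 / lam in cyl (x, p.2 / lam - sawtooth a x).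
have hE z : h (cyl z) =
    cyl (z.1 - z.2 / lam, z.2 / lam - sawtooth a (z.1 - z.2 / lam)).
  case: z => x y; rewrite /h /cyl /=.
  have hr : (repr (circle_of x) - x) / 2 \is a Num.int.
    by apply/circle_ofP; rewrite /circle_of reprK.
  have hs : (repr (circle_of x) - y / lam - (x - y / lam)) / 2
      \is a Num.int.
    by rewrite (_ : _ / 2 = (repr (circle_of x) - x) / 2) //; ring.
  by rewrite (sawtooth_periodic a hs); congr pair; apply/circle_ofP.
exists h => p; have [[x y] ->] := cyl_surj p.
- rewrite cylmapE hE /lift_map /=.
  have -> : lam * (y + sawtooth a x) / lam = y + sawtooth a x by field.
  have -> : x + y + sawtooth a x - (y + sawtooth a x) = x by ring.
  by congr cyl; congr pair; ring.
- rewrite hE cylmapE /lift_map /=.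
  by congr cyl; congr pair; [ring | field].
Qed.

Definition colv (R : realType) (v : R * R) : 'cV[R]_2 :=
  \col_i (if i == 0 then v.1 else v.2).

(* M is the derivative of f at the point covered by z.  A lift G of f near z
   which is continuous at z is unique up to a translation by (2k, 0) near z. *)
Definition has_linearization (R : realType) (f : cylinder R -> cylinder R)
    (z : R * R) (M : 'M[R]_2) : Prop :=
  exists G : R * R -> R * R,
    [/\ \forall w \near z, f (cyl w) = cyl (G w),
        differentiable G z &
        forall h : R * R, colv ('d G z h) = M *m colv h].

(* The attractor of a set U with f(U) included in U. *)
Definition attractor (T : Type) (f : T -> T) (U : set T) : set T :=
  \bigcap_(k in [set k : nat | (1 <= k)%N]) (iter k f @` U).

Definition trapping (T : topologicalType) (f : T -> T) (U : set T) : Prop :=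
  open U /\ f @` U `<=` U.

(* S is the singular set: it is formed of discontinuities of f and is present
   in the attractor L.  Outside S the derivative of f is M, which preserves
   the splitting of the plane into the lines spanned by eu and es, expanding
   the former and contracting the latter.  As eu and es are nonzero
   eigenvectors for distinct eigenvalues they are linearly independent. *)
Definition singular_hyperbolic (R : realType) (f : cylinder R -> cylinder R)
    (S L : set (cylinder R)) (M : 'M[R]_2) (eu es : R * R) : Prop :=
  [/\ forall p, S p -> ~ {for p, continuous f},
      S `&` L !=set0,
      forall z, ~ S (cyl z) -> has_linearization f z M,
      eu != 0 /\ es != 0 &
      exists mu1 mu2 : R,
        [/\ 1 < mu1, 0 < mu2 < 1,
            M *m colv eu = mu1 *: colv eu &
            M *m colv es = mu2 *: colv es]].

Definition discontinuity_line (R : realType) : set (cylinder R) :=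
  [set p | p.1 = circle_of 0].

Definition linA (R : realType) (lam a : R) : 'M[R]_2 :=
  \matrix_(i < 2, j < 2)
    nth 0 (nth [::] [:: [:: 1 + a; 1]; [:: lam * a; lam]] i) j.

Definition alpha1 (R : realType) (lam a : R) : R :=
  2^-1 * (- 1 - a + lam + Num.sqrt ((1 + a + lam) ^+ 2 - 4 * lam)).

Definition alpha2 (R : realType) (lam a : R) : R :=
  2^-1 * (- 1 - a + lam - Num.sqrt ((1 + a + lam) ^+ 2 - 4 * lam)).

Definition annulus (R : realType) (lam a : R) : set (cylinder R) :=
  [set p | `|p.2| < a / (1 - lam)].

Definition line (R : realType) (O : R * R) (s : R) : set (R * R) :=
  [set z | z.2 = O.2 + s * (z.1 - O.1)].

Definition O1 (R : realType) : R * R := (- 1, 0).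
Definition O2 (R : realType) : R * R := (1, 0).

Definition M2 (R : realType) (lam a : R) : R * R :=
  get (line (O1 R) (alpha1 lam a) `&` line (O2 R) (alpha2 lam a)).

Lemma M2P (R : realType) (lam a : R) : 0 < lam < 1 -> 1 - lam < a ->
  line (O1 R) (alpha1 lam a) `&` line (O2 R) (alpha2 lam a)
    = [set M2 lam a].
Proof.
move=> /andP[l0 l1] ha.
set L := _ `&` _.
pose s := Num.sqrt ((1 + a + lam) ^+ 2 - 4 * lam).
have s0 : 0 < s by rewrite sqrtr_gt0; nra.
have d0 : alpha1 lam a - alpha2 lam a = s.
  by rewrite /alpha1 /alpha2 -/s; field.
pose x := - (alpha1 lam a + alpha2 lam a) / s.
have LE : L = [set (x, alpha1 lam a * (x + 1))].
  apply/seteqP; split=> [[u v] [/= hu hv]|z -> /=].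
    have ux : u = x.
      apply: (mulIf (lt0r_neq0 s0)); rewrite /x divfK ?lt0r_neq0 // -d0.
      by move: hu hv; rewrite /line /= => ->; lra.
    by move: hu; rewrite /line /= ux opprK add0r => ->.
  split; rewrite /line /= ?opprK ?add0r //.
  have : x * s = - (alpha1 lam a + alpha2 lam a).
    by rewrite /x divfK ?lt0r_neq0.
  by rewrite -d0; lra.
suff -> : M2 lam a = (x, alpha1 lam a * (x + 1)) by [].
by rewrite /M2 -/L LE; apply: get_unique => // y ->.
Qed.

(* The closed parallelogram with consecutive vertices A, B, C, D, where
   C = B + D - A. *)
Definition parallelogram (R : realType) (A B D : R * R) : set (R * R) :=
  [set z | exists s t : R, [/\ 0 <= s <= 1, 0 <= t <= 1 &
     z = A + s *: (B - A) + t *: (D - A)]].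

(* As M2 + (- M2) - O1 = O2, the vertices are O1, M2, O2, - M2. *)
Definition paraP (R : realType) (lam a : R) : set (cylinder R) :=
  @cyl R @` parallelogram (O1 R) (M2 lam a) (- M2 lam a).

(* The lift of the orbit makes more than one turn, i.e., between some two of
   its points the horizontal displacement exceeds the circumference 2. *)
Definition winds (R : realType) (lam a : R) (p : cylinder R) : Prop :=
  exists (z : R * R) (n : nat),
    full_orbit (cylmap lam a) p (cyl z) /\
    2 < `|(iter n (lift_map lam a) z).1 - z.1|.

Definition attractorA (R : realType) (lam a : R) : set (cylinder R) :=
  attractor (cylmap lam a) (annulus lam a).

Definition oscillating (R : realType) (lam a : R) : set (cylinder R) :=
  [set p | attractorA lam a p /\
           full_orbit (cylmap lam a) p `<=` paraP lam a].

Definition rotating (R : realType) (lam a : R) : set (cylinder R) :=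
  [set p | [/\ attractorA lam a p,
     full_orbit (cylmap lam a) p `<=` annulus lam a `\` paraP lam a &
     winds lam a p]].

Definition rotating_oscillating (R : realType) (lam a : R) :
    set (cylinder R) :=
  [set p | [/\ attractorA lam a p,
     full_orbit (cylmap lam a) p `&` paraP lam a !=set0 &
     full_orbit (cylmap lam a) p `&` (annulus lam a `\` paraP lam a)
       !=set0]].

(* Main.v *)
Require Import Defs.
From HB Require Import structures.
From mathcomp Require Import all_boot all_order all_algebra.
From mathcomp Require Import all_classical all_reals all_analysis.
From mathcomp Require Import ring lra.

Set Implicit Arguments.
Unset Strict Implicit.
Unset Printing Implicit Defensive.

Import Order.TTheory GRing.Theory Num.Theory.
Import numFieldNormedType.Exports.

Local Open Scope classical_set_scope.
Local Open Scope ring_scope.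

(** The plane is cut into the cells 2k <= x < 2k + 2. On each of them the lift
of the map is affine with linear part [linA] and fixes the saddle (2k + 1,
0) in the middle of the cell, so that everything is read off two linear
coordinates U and V of the plane, which the linear part multiplies by its
eigenvalues m > 1 and n < 1. With lam = m n and a = (m - 1) (1 - n), all
quantities are polynomials in m and n, and the hypothesis 1 - lam < a
becomes m + n > 2. Write alpha1 = c, alpha2 = - b, U = y + b x and V = c x -
y. The parallelogram P is the rectangle |U| <= b, |V| <= c, and the saddle
in the cell with centre s has coordinates (s b, s c): on this cell U - s b
is multiplied by m and V - s c by n ([lift_eigen]).

An orbit of the attractor that remains outside P has to wind. If it does
not, its abscissae spread over at most 2 and meet at most two neighbouring
cells, which may be taken to have centres -1 and 1. There U - b and - U - b
grow at least by the factor m under each iteration, and V - c and - V - c at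
least by the factor 1 / n under each backward iteration. As they are bounded
along the orbit they are nonpositive, that is, the orbit lies in P
([nonwinding_in_paraP]). As the annulus contains the full orbits of the
points of the attractor, this splits the attractor into the three
components. Conversely, every point with a bounded backward orbit is in the
attractor ([bounded_past_attractor]), and this is how its points are found.

The unstable segment V = - c of the saddle (-1, 0), up to the line x = 0,
has a backward orbit that tends to the saddle ([unstable_ray_attractor]). It
contains the saddle, which oscillates, a point of the discontinuity line,
and points of P whose image has U > b, hence lies outside P: the image of
the segment is longer than the side of P on the same line exactly when m + n
> 2. A rotating orbit is found by solving F^N z = z + (2, 0) for an orbit
piece of length N inside one cell; this is a pair of scalar equations, and
when N is large the solution does stay in the cell, again because m + n > 2
([periodic_amplitudes]). In each cell it is above the saddle, which keeps it
outside P ([above_saddle_notin_paraP]). *)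

(** * Powers and iterates *)

Lemma expr_small (R : realType) (k e : R) :
  0 < k < 1 -> 0 < e -> \forall i \near \oo, k ^+ i < e.
Proof.
move=> /andP[k0 k1] e0; have k_lt1 : `|k| < 1 by rewrite gtr0_norm.
have /cvgrPdist_lt/(_ e e0) := cvg_expr k_lt1.
apply: filterS => i; rewrite sub0r normrN; exact/le_lt_trans/ler_norm.
Qed.

(** Iteration gives v 0 <= k ^ i * C, which tends to 0.  This is the form in
which uniform expansion is used: a quantity that grows by the factor 1 / k at
each step and is bounded above cannot have been positive. *)
Lemma contracted_bounded (R : realType) (v : nat -> R) (k C : R) :
  0 < k < 1 -> (forall i, v i <= k * v i.+1) -> (forall i, v i <= C) ->
  v 0 <= 0.
Proof.
move=> k01 vS vC; have /andP[k0 k1] := k01.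
rewrite leNgt; apply/negP => v0.
have C0 : 0 < C by apply: lt_le_trans (vC 0).
have vX i : v 0 <= k ^+ i * C.
  have: v 0 <= k ^+ i * v i.
    elim: i => [|i IH]; first by rewrite expr0 mul1r.
    apply: le_trans IH _; rewrite exprSr -mulrA.
    by rewrite ler_pM2l ?exprn_gt0.
  by move=> /le_trans; apply; rewrite ler_pM2l ?exprn_gt0.
have [i ki] := filter_ex (expr_small k01 (divr_gt0 v0 C0)).
by have := vX i; rewrite leNgt -ltr_pdivlMr ?ki.
Qed.

Lemma iter_inj (T : Type) (f : T -> T) j : injective f -> injective (iter j f).
Proof. by move=> fI; elim: j => //= j IH x y /fI/IH. Qed.

Section FullOrbits.
Context (T : Type) (f : T -> T) (fI : injective f) (z : T).

Lemma full_orbit_refl : full_orbit f z z.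
Proof. by exists 0%N; left. Qed.

Lemma full_orbit_image w : full_orbit f z w -> full_orbit f z (f w).
Proof.
case=> j [->|zw]; first by exists j.+1; left.
case: j zw => [->|j zw]; first by exists 1%N; left.
by exists j; right; rewrite -iterSr.
Qed.

Lemma full_orbit_preimage w : full_orbit f z (f w) -> full_orbit f z w.
Proof.
case=> j [|->]; last by exists j.+1; right; rewrite iterSr.
case: j => [fw|j /fI ->]; first by exists 1%N; right.
by exists j; left.
Qed.

(** Injectivity makes backward branches unique, so that a full orbit is
linearly ordered by the dynamics. *)
Lemma full_orbit_linear w w' : full_orbit f z w -> full_orbit f z w' ->
  exists j, w' = iter j f w \/ w = iter j f w'.
Proof.
move=> [i [->|zw]] [j [->|zw']].
- by case/orP: (leq_total i j) => ij; [exists (j - i)%N; left |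
    exists (i - j)%N; right]; rewrite -iterD subnK.
- by exists (i + j)%N; right; rewrite iterD -zw'.
- by exists (j + i)%N; left; rewrite iterD -zw.
case/orP: (leq_total i j) => ij.
- exists (j - i)%N; right; apply: (iter_inj (j := i) fI).
  by rewrite -iterD subnKC // -zw.
- exists (i - j)%N; left; apply: (iter_inj (j := j) fI).
  by rewrite -iterD subnKC // -zw'.
Qed.

End FullOrbits.

Lemma iter_fixed (T : Type) (f : T -> T) N i p :
  iter N f p = p -> iter (i * N) f p = p.
Proof. by move=> fp; elim: i => // i IH; rewrite mulSn iterD IH. Qed.

(** Going i steps backward along a cycle of length N amounts to going i N - i
steps forward. *)
Lemma full_orbit_periodic (T : Type) (f : T -> T) N p q : injective f ->
  (0 < N)%N -> iter N f p = p -> full_orbit f p q -> exists i, q = iter i f p.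
Proof.
move=> fI N0 fp [i [->|pq]]; first by exists i.
exists (i * N - i)%N; apply: (iter_inj (j := i) fI).
by rewrite -pq -iterD subnKC ?leq_pmulr // iter_fixed.
Qed.

(** * The lift of the map to the plane *)

Lemma sawtooth_cell (R : realType) (a x : R) (k : int) :
  2 * k%:~R <= x < 2 * k%:~R + 2 ->
  sawtooth a x = a * (x - (2 * k%:~R + 1)).
Proof.
move=> /andP[kx xk]; rewrite /sawtooth (_ : Num.floor (x / 2) = k); first ring.
by apply: floor_def; rewrite intrD ler_pdivlMr // ltr_pdivrMr //; lra.
Qed.

Lemma cell_exists (R : realType) (x : R) :
  exists k : int, 2 * k%:~R <= x < 2 * k%:~R + 2.
Proof.
exists (Num.floor (x / 2)).
have /andP[] := floor_itv (x / 2).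
by rewrite intrD ler_pdivlMr // ltr_pdivrMr //; lra.
Qed.

Lemma sawtooth_bound (R : realType) (a x : R) :
  0 <= a -> `|sawtooth a x| <= a.
Proof.
move=> a0; have [k /[dup] kx /sawtooth_cell->] := cell_exists x.
by rewrite normrM ger0_norm // ler_piMr // ler_norml; lra.
Qed.

Lemma cyl_shift (R : realType) (z w : R * R) :
  cyl z = cyl w -> exists k : int, w = z + (2 * k%:~R, 0).
Proof.
case: z w => [x y] [x' y'] [/esym/circle_ofP/intrP[k kE] <-].
exists k; congr pair; last by rewrite /= addr0.
by rewrite /= -kE; field.
Qed.

Lemma shift_cyl (R : realType) (z : R * R) (k : int) :
  cyl (z + (2 * k%:~R, 0)) = cyl z.
Proof.
case: z => x y; congr pair; last by rewrite /= addr0.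
by apply/circle_ofP; rewrite /= (_ : _ / 2 = k%:~R) ?intr_int //; field.
Qed.

Lemma lift_map_shift (R : realType) (lam a : R) (z : R * R) (k : int) :
  lift_map lam a (z + (2 * k%:~R, 0)) = lift_map lam a z + (2 * k%:~R, 0).
Proof.
case: z => x y; rewrite /lift_map /=.
rewrite (@sawtooth_periodic _ a (x + 2 * k%:~R) x); last first.
  by rewrite (_ : _ / 2 = k%:~R) ?intr_int //; field.
by congr pair => /=; ring.
Qed.

Lemma iter_lift_map_shift (R : realType) (lam a : R) (z : R * R) (k : int) j :
  iter j (lift_map lam a) (z + (2 * k%:~R, 0)) =
  iter j (lift_map lam a) z + (2 * k%:~R, 0).
Proof. by elim: j => //= j ->; rewrite lift_map_shift. Qed.

Lemma iter_cylmap (R : realType) (lam a : R) (z : R * R) j :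
  iter j (cylmap lam a) (cyl z) = cyl (iter j (lift_map lam a) z).
Proof. by elim: j => //= j ->; rewrite cylmapE. Qed.

Definition lift_inv (R : realType) (lam a : R) (z : R * R) : R * R :=
  (z.1 - z.2 / lam, z.2 / lam - sawtooth a (z.1 - z.2 / lam)).

Lemma lift_mapK (R : realType) (lam a : R) :
  lam != 0 -> cancel (lift_map lam a) (lift_inv lam a).
Proof.
move=> l0 [x y]; rewrite /lift_inv /lift_map /=.
have -> : lam * (y + sawtooth a x) / lam = y + sawtooth a x by field.
have -> : x + y + sawtooth a x - (y + sawtooth a x) = x by ring.
by congr pair; ring.
Qed.

Lemma lift_invK (R : realType) (lam a : R) :
  lam != 0 -> cancel (lift_inv lam a) (lift_map lam a).
Proof.
by move=> l0 [x y]; rewrite /lift_inv /lift_map /=; congr pair; [ring|field].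
Qed.

Lemma full_orbit_cyl (R : realType) (lam a : R) z w :
  full_orbit (lift_map lam a) z w -> full_orbit (cylmap lam a) (cyl z) (cyl w).
Proof.
by case=> j [->|->]; exists j; [left | right]; rewrite iter_cylmap.
Qed.

Lemma full_orbit_shift (R : realType) (lam a : R) z (k : int) w :
  full_orbit (lift_map lam a) (z + (2 * k%:~R, 0)) (w + (2 * k%:~R, 0)) ->
  full_orbit (lift_map lam a) z w.
Proof.
by case=> j [] /(congr1 (fun x => x - (2 * k%:~R, 0)));
  rewrite iter_lift_map_shift !addrK => ->; exists j; [left | right].
Qed.

(** * The annulus and its attractor *)

Section Annulus.
Context (R : realType) (lam a : R).
Hypotheses (l01 : 0 < lam < 1) (a0 : 0 < a).
Let f := cylmap lam a.

Let cylmap_inj : injective f.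
Proof. by apply/bij_inj/cylmap_bij; have /andP[/lt0r_neq0] := l01. Qed.

Lemma cylmap_height p : `|(f p).2| <= lam * (`|p.2| + a).
Proof.
have /andP[l0 _] := l01.
have [[x y] ->] := cyl_surj p; rewrite /f cylmapE /= normrM (gtr0_norm l0).
rewrite ler_pM2l //.
by apply: le_trans (ler_normD _ _) _; rewrite lerD2l sawtooth_bound // ltW.
Qed.

(** The height D = a / (1 - lam) of the annulus satisfies lam (D + a) < D,
since lam (2 - lam) < 1. *)
Lemma annulus_trapping : trapping f (annulus lam a).
Proof.
have /andP[l0 l1] := l01; have l1' : 0 < 1 - lam by rewrite subr_gt0.
split.
  have -> : annulus lam a = snd @^-1` [set y : R | `|y| < a / (1 - lam)] by [].
  apply: open_comp; first by move=> p _; exact: cvg_snd.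
  apply: (@open_comp _ _ (Num.norm : R -> R) [set y | y < _]).
    by move=> y _; exact: norm_continuous.
  exact: open_lt.
move=> _ [p pA <-]; apply: le_lt_trans (cylmap_height p) _.
move: pA; rewrite /annulus /= ltr_pdivlMr // ltr_pdivlMr // => pA.
have := ltr_pM2l l0 (`|p.2| * (1 - lam)) a; rewrite pA => lpA.
have := mulr_gt0 a0 (mulr_gt0 l1' l1'); lra.
Qed.

Lemma iter_annulus p j : annulus lam a p -> annulus lam a (iter j f p).
Proof.
move=> pA; elim: j => //= j IH.
by have [_] := annulus_trapping; apply; exists (iter j f p).
Qed.

(** The heights satisfy |y'| <= lam (|y| + a), and D = lam a / (1 - lam) is the
fixed point of this recursion.  Hence the excess over D is expanded by 1 / lam
backward in time, and a bounded past forces |y| <= D < a / (1 - lam). *)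
Lemma bounded_past_annulus (q : nat -> cylinder R) (C : R) :
  (forall j, f (q j.+1) = q j) -> (forall j, `|(q j).2| <= C) ->
  annulus lam a (q 0).
Proof.
move=> qS qC; have /andP[l0 l1] := l01.
have l1' : 0 < 1 - lam by rewrite subr_gt0.
pose D := lam * a / (1 - lam).
have DE : D = lam * (D + a) by rewrite /D; field; rewrite lt0r_neq0.
have : `|(q 0).2| - D <= 0.
  apply: (@contracted_bounded _ (fun j => `|(q j).2| - D) lam (C - D)) => //.
    by move=> j; have := cylmap_height (q j.+1); rewrite qS; lra.
  by move=> j; rewrite lerD2r.
rewrite subr_le0 => /le_lt_trans; apply.
by rewrite /D ltr_pM2r ?invr_gt0 // -[ltRHS]mul1r ltr_pM2r.
Qed.

(** Every point of a bounded backward orbit has itself a bounded past, hence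
lies in the annulus. *)
Lemma bounded_past_attractor (q : nat -> cylinder R) (C : R) :
  (forall j, f (q j.+1) = q j) -> (forall j, `|(q j).2| <= C) ->
  attractorA lam a (q 0).
Proof.
move=> qS qC k _; exists (q k).
  have := @bounded_past_annulus (fun j => q (k + j)%N) C.
  rewrite addn0; apply => j; last exact: qC.
  by rewrite addnS.
by elim: k => // k IH; rewrite iterSr -/f qS.
Qed.

(** A point of the attractor has a preimage of each order in the annulus, and
this preimage is the only one. *)
Lemma attractor_orbit_annulus p :
  attractorA lam a p -> full_orbit f p `<=` annulus lam a.
Proof.
have past j q : attractorA lam a (iter j f q) -> annulus lam a q.
  move=> /(_ j.+1 isT)[r rA]; rewrite iterSr => /(iter_inj cylmap_inj) <-.
  by apply: (iter_annulus 1).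
move=> pA q [j [->|qp]]; last by apply: (past j); rewrite -qp.
exact/iter_annulus/(past 0).
Qed.

End Annulus.

(** * Coordinates along the eigenvectors *)

(** The eigenvalues m and n of A have product det A = lam and sum
tr A = 1 + a + lam, which gives a = (m - 1) (1 - n). *)
Lemma eigenvalue_parameters (R : realType) (lam a : R) :
  0 < lam < 1 -> 1 - lam < a ->
  exists m n : R,
    [/\ 1 < m, 0 < n, n < 1, lam = m * n & a = (m - 1) * (1 - n)].
Proof.
move=> /andP[l0 l1] al.
pose D := (1 + a + lam) ^+ 2 - 4 * lam; pose s := Num.sqrt D.
have D0 : 0 < D by rewrite /D; nra.
have s0 : 0 < s by rewrite sqrtr_gt0.
have sD : s * s = D by rewrite -expr2 sqr_sqrtr // ltW.
pose m := (1 + a + lam + s) / 2; pose n := (1 + a + lam - s) / 2.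
have mD : m + n = 1 + a + lam by rewrite /m /n; field.
have mM : m * n = lam.
  have -> : m * n = ((1 + a + lam) ^+ 2 - s * s) / 4 by rewrite /m /n; field.
  by rewrite sD /D; field.
have n0 : 0 < n.
  by rewrite -(pmulr_rgt0 _ (_ : 0 < m)) ?mM // /m; lra.
have mn : n < m by rewrite /m /n; lra.
have pr : (m - 1) * (1 - n) = a by nra.
have [m1 n1] : 1 < m /\ n < 1 by split; nra.
by exists m, n.
Qed.

(** The linear form that vanishes on the stable direction, of slope
- m (1 - n), normalized to be m (1 - n) at the saddle (1, 0). *)
Definition ucoord (R : realType) (m n : R) (z : R * R) : R :=
  z.2 + m * (1 - n) * z.1.

(** The linear form that vanishes on the unstable direction, of slope
n (m - 1), normalized to be n (m - 1) at the saddle (1, 0). *)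
Definition scoord (R : realType) (m n : R) (z : R * R) : R :=
  n * (m - 1) * z.1 - z.2.

(** The inverse of the coordinate map. *)
Definition eigenpt (R : realType) (m n u v : R) : R * R :=
  ((u + v) / (m - n), (n * (m - 1) * u - m * (1 - n) * v) / (m - n)).

Section Eigenvalues.
Context (R : realType) (m n : R).
Hypotheses (m1 : 1 < m) (n0 : 0 < n) (n1 : n < 1).
Let lam : R := m * n.
Let a : R := (m - 1) * (1 - n).
Let b : R := m * (1 - n).
Let c : R := n * (m - 1).
Let F := lift_map lam a.
Let f := cylmap lam a.
Let U := ucoord m n.
Let V := scoord m n.
Let pt := eigenpt m n.

Let m0 : 0 < m. Proof. exact: lt_trans m1. Qed.
Let b0 : 0 < b. Proof. by rewrite mulr_gt0 ?subr_gt0. Qed.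
Let c0 : 0 < c. Proof. by rewrite mulr_gt0 ?subr_gt0. Qed.
Let a0 : 0 < a. Proof. by rewrite mulr_gt0 ?subr_gt0. Qed.
Let mn0 : 0 < m - n. Proof. by rewrite subr_gt0 (lt_trans n1). Qed.
Let bc : b + c = m - n. Proof. by rewrite /b /c; ring. Qed.
Let lam0 : lam != 0. Proof. by rewrite lt0r_neq0 // mulr_gt0. Qed.
Let F_inj : injective F. Proof. exact: can_inj (lift_mapK _ lam0). Qed.
Let f_inj : injective f. Proof. exact/bij_inj/cylmap_bij. Qed.

Lemma sqrt_discriminant :
  Num.sqrt ((1 + a + lam) ^+ 2 - 4 * lam) = m - n.
Proof.
rewrite (_ : _ - _ = (m - n) ^+ 2); last by rewrite /a /lam; ring.
by rewrite sqrtr_sqr gtr0_norm.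
Qed.

Lemma alpha1E : alpha1 lam a = c.
Proof. by rewrite /alpha1 sqrt_discriminant /a /lam /c; field. Qed.

Lemma alpha2E : alpha2 lam a = - b.
Proof. by rewrite /alpha2 sqrt_discriminant /a /lam /b; field. Qed.

Lemma ucoordK u v : U (pt u v) = u.
Proof. by rewrite /U /ucoord /=; field; rewrite lt0r_neq0. Qed.

Lemma scoordK u v : V (pt u v) = v.
Proof. by rewrite /V /scoord /=; field; rewrite lt0r_neq0. Qed.

Lemma eigenptK z : pt (U z) (V z) = z.
Proof.
by case: z => x y; congr pair; rewrite /U /V /ucoord /scoord /=; field;
  rewrite lt0r_neq0.
Qed.

Lemma eigenpt_shift u v (k : int) :
  pt (u + 2 * k%:~R * b) (v + 2 * k%:~R * c) = pt u v + (2 * k%:~R, 0).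
Proof. by congr pair; rewrite /b /c /=; field; rewrite lt0r_neq0. Qed.

Lemma lift_eigen z (k : int) :
  2 * k%:~R <= z.1 < 2 * k%:~R + 2 ->
  F z = pt (m * U z - (m - 1) * b * (2 * k%:~R + 1))
           (n * V z + (1 - n) * c * (2 * k%:~R + 1)).
Proof.
case: z => x y /= /sawtooth_cell xk; rewrite /F /lift_map /= xk.
congr pair; rewrite /U /V /ucoord /scoord /lam /a /b /c /=; field;
  by rewrite lt0r_neq0.
Qed.

(** The action of the lift in coordinates relative to the saddle of the cell,
which are (b s, c s) for its centre s = 2 k + 1. *)
Lemma lift_eigenpt u v (k : int) :
  - (m - n) <= u + v < m - n ->
  F (pt (u + b * (2 * k%:~R + 1)) (v + c * (2 * k%:~R + 1))) =
  pt (m * u + b * (2 * k%:~R + 1)) (n * v + c * (2 * k%:~R + 1)).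
Proof.
move=> /andP[uv1 uv2]; rewrite (@lift_eigen _ k) ?ucoordK ?scoordK.
  by congr pt; ring.
rewrite /= ler_pdivlMr // ltr_pdivrMr // -bc.
by move: uv1 uv2; rewrite -bc; lra.
Qed.

Hypotheses (lam1 : 0 < 1 - lam) (lama : 1 - lam < a).

Let lam01 : 0 < lam < 1. Proof. by rewrite mulr_gt0 // -subr_gt0. Qed.
Let mn2 : 0 < m + n - 2. Proof. by move: lama; rewrite /lam /a; lra. Qed.

Lemma M2_eigen : M2 lam a = pt b (- c).
Proof.
have : [set M2 lam a] (M2 lam a) by [].
rewrite -M2P //; case: (M2 lam a) => x y [].
rewrite /line /= alpha1E alpha2E => y1 y2.
rewrite -[(x, y)]eigenptK /U /V /ucoord /scoord /=; congr pt; move: y1 y2.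
- by rewrite -/b; lra.
- by rewrite -/c; lra.
Qed.

(** The sides of P are along the eigenvectors, its centre is the origin, and
its vertex (1, 0) has coordinates (b, c). *)
Lemma parallelogram_eigen z :
  parallelogram (O1 R) (M2 lam a) (- M2 lam a) z <->
  `|U z| <= b /\ `|V z| <= c.
Proof.
rewrite M2_eigen.
have O1E : O1 R = pt (- b) (- c).
  by congr pair; rewrite /b /c /=; field; rewrite lt0r_neq0.
have stE s t : O1 R + s *: (pt b (- c) - O1 R) + t *: (- pt b (- c) - O1 R) =
    pt (b * (2 * s - 1)) (c * (2 * t - 1)).
  by rewrite O1E; congr pair; rewrite /b /c /= /GRing.scale /=; field;
    rewrite lt0r_neq0.
split=> [[s [t [s01 t01 ->]]]|[Ub Vc]].
  rewrite stE ucoordK scoordK (normrM b) (normrM c).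
  rewrite (gtr0_norm b0) (gtr0_norm c0) !ler_piMr ?(ltW b0) ?(ltW c0) //;
  by rewrite ler_norml; lra.
exists ((U z / b + 1) / 2), ((V z / c + 1) / 2).
move: Ub Vc; rewrite !ler_norml => /andP[Ub1 Ub2] /andP[Vc1 Vc2].
have Ub3 : -1 <= U z / b <= 1.
  by rewrite ler_pdivlMr // ler_pdivrMr // mulN1r mul1r Ub1.
have Vc3 : -1 <= V z / c <= 1.
  by rewrite ler_pdivlMr // ler_pdivrMr // mulN1r mul1r Vc1.
split; [lra | lra | rewrite stE -[LHS]eigenptK].
by congr pt; field; rewrite lt0r_neq0.
Qed.

(** * Orbits that do not wind *)

(** Allowing any s in [-1, 1] as centre gives a form of [lift_eigen] that
does not mention in which of the two cells z lies. *)
Lemma two_cells (z : R * R) : -2 <= z.1 < 2 -> exists s, [/\ -1 <= s <= 1,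
  U (F z) = m * U z - (m - 1) * b * s & V (F z) = n * V z + (1 - n) * c * s].
Proof.
move=> /andP[z1 z2].
have [k kz k1] : exists2 k : int, 2 * k%:~R <= z.1 < 2 * k%:~R + 2 &
    -1 <= (2 * k%:~R + 1 : R) <= 1.
  have [zlt0|zge0] := ltP z.1 0.
    by exists (-1); rewrite mulrNz mulr1z; lra.
  by exists 0; rewrite mulr0z; lra.
exists (2 * k%:~R + 1); split => //.
- by rewrite (lift_eigen kz) ucoordK.
- by rewrite (lift_eigen kz) scoordK.
Qed.

(** While the orbit remains in two cells with |s| <= 1, the distance of U
above b or below - b is expanded by m forward in time, and that of V above c or
below - c is expanded by 1 / n backward in time. *)
Lemma confined_orbit_eigen (z : R * R) (C : R) :
  (forall w, full_orbit F z w -> -2 <= w.1 < 2 /\ `|w.2| <= C) ->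
  `|U z| <= b /\ `|V z| <= c.
Proof.
move=> zC.
have UV w : full_orbit F z w ->
    [/\ U w <= C + b * 2, - U w <= C + b * 2, V w <= C + c * 2 &
        - V w <= C + c * 2].
  move=> /zC[/andP[w1 w2]]; rewrite ler_norml => /andP[w3 w4].
  have x2 : -2 <= w.1 <= 2 by rewrite w1 ltW.
  have bx : `|b * w.1| <= b * 2.
    by rewrite (normrM b) (gtr0_norm b0) ler_pM2l // ler_norml.
  have cx : `|c * w.1| <= c * 2.
    by rewrite (normrM c) (gtr0_norm c0) ler_pM2l // ler_norml.
  move: bx cx; rewrite !ler_norml => /andP[bx1 bx2] /andP[cx1 cx2].
  by rewrite /U /V /ucoord /scoord -/b -/c; split; lra.
have fwd j : full_orbit F z (iter j F z) by exists j; left.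
pose G := lift_inv lam a.
have GK : cancel G F by exact: lift_invK.
have bwd j : full_orbit F z (iter j G z).
  elim: j => [|j IH]; first exact: full_orbit_refl.
  by apply: (full_orbit_preimage F_inj); rewrite /= GK.
have m01 : 0 < m^-1 < 1.
  by rewrite invr_gt0 invf_lt1 ?m1 m0.
have n01 : 0 < n < 1 by rewrite n0 n1.
have dm : 0 < (m - 1) * b by rewrite mulr_gt0 ?subr_gt0.
have dn : 0 < (1 - n) * c by rewrite mulr_gt0 ?subr_gt0.
have zS w : full_orbit F z w ->
    `|U (F w) - m * U w| <= (m - 1) * b /\ `|V (F w) - n * V w| <= (1 - n) * c.
  move=> /zC[/two_cells[s [s1 -> ->]] _]; rewrite -ler_norml in s1.
  rewrite addrAC subrr add0r normrN addrAC subrr add0r.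
  rewrite !(normrM (_ * _)) (gtr0_norm dm) (gtr0_norm dn).
  by rewrite !ler_piMr // ltW.
have expand (v : nat -> R) D : (forall j, m * v j <= v j.+1) ->
    (forall j, v j <= D) -> v 0 <= 0.
  move=> vm; apply: (contracted_bounded m01) => j.
  by rewrite ler_pdivlMl // m0.
split; rewrite ler_norml; apply/andP; split.
- suff: - U z - b <= 0 by lra.
  apply: (expand (fun j => - U (iter j F z) - b) (C + b * 2)) => j.
    by have [] := zS _ (fwd j); rewrite ler_norml /=; lra.
  by have := b0; have := c0; have [] := UV _ (fwd j) => /=; lra.
- suff: U z - b <= 0 by lra.
  apply: (expand (fun j => U (iter j F z) - b) (C + b * 2)) => j.
    by have [] := zS _ (fwd j); rewrite ler_norml /=; lra.
  by have := b0; have := c0; have [] := UV _ (fwd j) => /=; lra.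
- suff: - V z - c <= 0 by lra.
  apply: (@contracted_bounded _ (fun j => - V (iter j G z) - c) n (C + c * 2))
    => // j.
    by have /= [_] := zS _ (bwd j.+1); rewrite GK ler_norml; lra.
  by have := b0; have := c0; have [] := UV _ (bwd j) => /=; lra.
- suff: V z - c <= 0 by lra.
  apply: (@contracted_bounded _ (fun j => V (iter j G z) - c) n (C + c * 2))
    => // j.
    by have /= [_] := zS _ (bwd j.+1); rewrite GK ler_norml; lra.
  by have := b0; have := c0; have [] := UV _ (bwd j) => /=; lra.
Qed.

(** Without winding, the abscissae of any two points of the lifted full orbit
differ by at most 2, because one of the points is an iterate of the other.  So
they fit in two neighbouring cells, and a translation brings these to the
centres -1 and 1. *)
Lemma nonwinding_in_paraP p (C : R) :
  (forall q, full_orbit f p q -> `|q.2| <= C) ->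
  ~ winds lam a p -> paraP lam a p.
Proof.
have [z ->] := cyl_surj p => zC nw.
have near w w' : full_orbit F z w -> full_orbit F z w' -> `|w.1 - w'.1| <= 2.
  move=> zw zw'; rewrite leNgt; apply/negP => far; apply: nw.
  have [j [w'E|wE]] := full_orbit_linear F_inj zw zw'.
    exists w, j; split; first exact: full_orbit_cyl.
    by rewrite -/F -w'E distrC.
  exists w', j; split; first exact: full_orbit_cyl.
  by rewrite -/F -wE.
have [k zk] : exists k : int, forall w, full_orbit F z w ->
    2 * k%:~R <= w.1 < 2 * k%:~R + 4.
  have [k zk] := cell_exists z.1.
  have zz := full_orbit_refl F z.
  (* The cell of z is the right one of the two or the left one. *)
  have [[w0 zw0 w0k]|nolow] :=
      pselect (exists2 w, full_orbit F z w & w.1 < 2 * k%:~R).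
    exists (k - 1) => w zw; rewrite intrD mulrNz mulr1z.
    have := near _ _ zz zw; have := near _ _ zw zw0.
    by move: zk; rewrite !ler_norml; lra.
  exists k => w zw; have := near _ _ zz zw.
  have : 2 * k%:~R <= w.1.
    by rewrite leNgt; apply/negP => ?; apply: nolow; exists w.
  by move: zk; rewrite ler_norml; lra.
pose k' := - (k + 1); have k'E : 2 * k'%:~R = - 2 * k%:~R - 2 :> R.
  by rewrite /k' mulrNz intrD mulr1z; ring.
rewrite -(shift_cyl z k'); exists (z + (2 * k'%:~R, 0)) => //.
apply/parallelogram_eigen.
apply: (@confined_orbit_eigen _ C) => w'.
pose w := w' - (2 * k'%:~R, 0); have -> : w' = w + (2 * k'%:~R, 0).
  by rewrite subrK.
move=> /full_orbit_shift zw; split.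
  by have := zk _ zw; rewrite /= k'E; lra.
by rewrite /= addr0; exact: (zC _ (full_orbit_cyl zw)).
Qed.

(** * Points of the three components *)

(** The hypothesis says that z is above both the stable and the unstable line
of the saddle (2 k + 1, 0). A translate of P by a multiple of (2, 0) lies on
the lower side of the stable line if that saddle is its right vertex or is
further to the right, and on the lower side of the unstable line if that
saddle is its left vertex or is further to the left; one of the two always
happens. *)
Lemma above_saddle_notin_paraP z (k : int) :
  b * (2 * k%:~R + 1) < U z -> V z < c * (2 * k%:~R + 1) ->
  ~ paraP lam a (cyl z).
Proof.
move=> Uz Vz [w /parallelogram_eigen[Uw Vw]].
move=> /esym/cyl_shift[j wE]; move: Uw Vw.
rewrite !ler_norml => /andP[_ Ub] /andP[Vb _].
have kj0 : (k + j)%:~R < 0 :> R.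
  rewrite -(pmulr_rlt0 _ b0) intrD.
  by move: Ub Uz; rewrite wE /U /ucoord /= -/b; lra.
have kj1 : (-1)%:~R < (k + j)%:~R :> R.
  rewrite mulrNz mulr1z -subr_gt0 -(pmulr_rgt0 _ c0) intrD.
  by move: Vb Vz; rewrite wE /V /scoord /= -/c; lra.
by move: kj1; rewrite ltr_int -lezD1 addNr leNgt -(ltr_int R) kj0.
Qed.

(** These are the points of the unstable line V = - c through the saddle (-1, 0)
with -1 <= x <= 0.  Their backward orbit contracts to the saddle by 1 / m inside
the cell with centre -1; the right end point, at x = 0, is the image of an
interior point of that cell although it belongs to the next one. *)
Lemma unstable_ray_attractor d :
  0 <= d <= m - n -> attractorA lam a (cyl (pt (d - b) (- c))).
Proof.
move=> /andP[d0 dmn].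
pose q j := cyl (pt (d * m^-1 ^+ j - b) (- c)).
have -> : cyl (pt (d - b) (- c)) = q 0%N by rewrite /q expr0 mulr1.
have mj0 j : 0 < m^-1 ^+ j by rewrite exprn_gt0 ?invr_gt0.
have mj1 j : m^-1 ^+ j <= 1.
  by rewrite exprn_ile1 // ?invf_le1 ?invr_ge0 // ltW.
have dj0 j : 0 <= d * m^-1 ^+ j by rewrite mulr_ge0 // ltW.
have djmn j : d * m^-1 ^+ j <= m - n.
  by apply: le_trans dmn; rewrite ler_piMr.
apply: (@bounded_past_attractor _ _ _ lam01 a0 q c) => j.
  rewrite /q cylmapE -/F; congr cyl.
  have := @lift_eigenpt (d * m^-1 ^+ j.+1) 0 (-1).
  rewrite mulrNz mulr1z.
  have -> : 2 * -1 + 1 = -1 :> R by ring.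
  rewrite !mulrN1 !add0r !mulr0 !add0r addr0 => ->; last first.
    apply/andP; split.
      by apply: le_trans (dj0 _); rewrite oppr_le0 ltW.
    rewrite exprSr mulrA ltr_pdivrMr //; apply: le_lt_trans (djmn _) _.
    by rewrite ltr_pMr.
  by rewrite exprS mulrCA mulVKf // gt_eqF.
rewrite /= -/b -/c.
have -> : (c * (d * m^-1 ^+ j - b) - b * - c) / (m - n) =
    c * (d * m^-1 ^+ j / (m - n)) by rewrite [RHS]mulrA; congr (_ / _); ring.
rewrite (normrM c) (gtr0_norm c0) ger_pMr // ger0_norm ?divr_ge0 ?(ltW mn0) //.
by rewrite ler_pdivrMr // mul1r.
Qed.

Lemma oscillating_nonempty : oscillating lam a !=set0.
Proof.
exists (cyl (pt (- b) (- c))).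
have fixp : f (cyl (pt (- b) (- c))) = cyl (pt (- b) (- c)).
  rewrite /f cylmapE -/F; congr cyl.
  have := @lift_eigenpt 0 0 (-1).
  rewrite mulrNz mulr1z !mulr0 !add0r.
  have -> : 2 * -1 + 1 = -1 :> R by ring.
  by rewrite !mulrN1; apply; rewrite oppr_le0 ltW.
split.
  rewrite -[- b]add0r; apply: unstable_ray_attractor.
  by rewrite lexx ltW.
move=> q /(full_orbit_periodic (N := 1) f_inj isT fixp)[i ->].
have := @iter_fixed _ f 1 i _ fixp; rewrite muln1 => ->.
exists (pt (- b) (- c)) => //.
apply/parallelogram_eigen.
by rewrite ucoordK // scoordK // !normrN !gtr0_norm.
Qed.

Lemma attractor_meets_discontinuity :
  @discontinuity_line R `&` attractorA lam a !=set0.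
Proof.
exists (cyl (pt (m - n - b) (- c))); split.
  rewrite /discontinuity_line /= (_ : _ / _ = 0) //.
  by rewrite (_ : _ - _ = 0) ?mul0r // /b /c; ring.
by apply: unstable_ray_attractor; rewrite lexx ltW.
Qed.

Lemma rotating_oscillating_nonempty : rotating_oscillating lam a !=set0.
Proof.
have mn2' : 0 < m + n - 2 by [].
(* The point is in the cell when d < m - n, and its image is beyond the side
U = b of P when m d > 2 b = 2 m (1 - n); d is the midpoint of this interval. *)
pose d := (m - n + 2 * (1 - n)) / 2.
have d0 : 0 < d by rewrite /d; have := n1; lra.
have dmn : d < m - n by rewrite /d; lra.
have md : 2 * b < m * d.
  by rewrite /b mulrCA ltr_pM2l // /d; lra.
have d2b : d <= 2 * b.
  apply: le_trans (ltW dmn) _.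
  by move: lam1; rewrite /b /lam; lra.
exists (cyl (pt (d - b) (- c))).
have dA : attractorA lam a (cyl (pt (d - b) (- c))).
  by apply: unstable_ray_attractor; rewrite !ltW.
split => //.
  exists (cyl (pt (d - b) (- c))); split; first exact: full_orbit_refl.
  exists (pt (d - b) (- c)) => //.
  apply/parallelogram_eigen.
  rewrite ucoordK // scoordK // normrN -/b -/c (gtr0_norm c0) lexx.
  by rewrite ler_norml; split => //; have := d0; lra.
exists (f (cyl (pt (d - b) (- c)))).
have fO : full_orbit f (cyl (pt (d - b) (- c))) (f (cyl (pt (d - b) (- c)))).
  exact/full_orbit_image/full_orbit_refl.
split => //; split; first exact: attractor_orbit_annulus dA _ fO.
rewrite /f cylmapE -/F.
have := @lift_eigenpt d 0 (-1).
rewrite mulrNz mulr1z !mulr0 !add0r.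
have -> : 2 * -1 + 1 = -1 :> R by ring.
rewrite !mulrN1 addr0 => ->; last first.
  by rewrite dmn andbT (le_trans _ (ltW d0)) // oppr_le0 ltW.
apply: (@above_saddle_notin_paraP _ 0).
  by rewrite ucoordK // mulr0z mulr0 add0r mulr1; have := md; lra.
by rewrite scoordK // mulr0z mulr0 add0r mulr1; have := c0; lra.
Qed.

(** X and Y are the coordinates, relative to the saddle of a cell, of a point
which N iterations inside this cell translate by (2, 0), whose coordinates are
(2 b, 2 c).  As N grows, X m ^ (N - 1) tends to 2 b / m = 2 (1 - n) and Y tends
to - 2 c, whereas the cell has half-width m - n in these coordinates.  The
bound 2 (1 - n) < m - n is m + n > 2, and 2 c < m - n is b > c. *)
Lemma periodic_amplitudes : exists (N : nat) (X Y : R),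
  [/\ (0 < N)%N, 0 < X, - (m - n) <= Y < 0,
      forall j, (j < N)%N -> m ^+ j * X < m - n &
      m ^+ N * X = X + 2 * b /\ n ^+ N * Y = Y + 2 * c].
Proof.
have m01 : 0 < m^-1 < 1 by rewrite invr_gt0 invf_lt1 ?m1 // m0.
have n01 : 0 < n < 1 by rewrite n0 n1.
have bc_gt0 : 0 < b - c by move: lam1 mn2; rewrite /b /c /lam; lra.
have [N [[N0 mN] nN]] := filter_ex (filterI (filterI (nbhs_infty_gt 0)
  (expr_small m01 (divr_gt0 mn2 mn0))) (expr_small n01 (divr_gt0 bc_gt0 mn0))).
have mN0 : 0 < m ^+ N - 1 by rewrite subr_gt0 exprn_egt1 // -lt0n.
have nN0 : 0 < 1 - n ^+ N by rewrite subr_gt0 exprn_ilt1 // ?ltW // -lt0n.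
exists N, (2 * b / (m ^+ N - 1)), (- (2 * c / (1 - n ^+ N))); split => //.
- by rewrite divr_gt0 // mulr_gt0.
- apply/andP; split; last by rewrite oppr_lt0 divr_gt0 // mulr_gt0.
  rewrite lerN2 ler_pdivrMr //.
  by move: nN; rewrite ltr_pdivlMr // /b /c; lra.
- move=> j jN; rewrite mulrA ltr_pdivrMr //.
  have jN' : m ^+ j * m <= m ^+ N by rewrite -exprSr ler_eXn2l.
  move: mN; rewrite exprVn ltr_pdivlMr // mulrC ltr_pdivrMr ?exprn_gt0 // => mN.
  have -> : m ^+ j * (2 * b) = 2 * (1 - n) * (m ^+ j * m) by rewrite /b; ring.
  have n2 : 0 < 2 * (1 - n) by rewrite mulr_gt0 ?subr_gt0.
  by move: jN' mN; rewrite -(ler_pM2l n2); lra.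
- by split; field; rewrite lt0r_neq0.
Qed.

(** The orbit of the point of [periodic_amplitudes] in the cell with centre 1.
In each cell it has U above and V below the values at the saddle, so it is
above the saddle; each N iterations advance it by one turn. *)
Lemma rotating_nonempty : rotating lam a !=set0.
Proof.
have [N [X [Y [N0 X0 /andP[Ymn Y0] Xmn [XN YN]]]]] := periodic_amplitudes.
pose w (k : int) := pt (X + b * (2 * k%:~R + 1)) (Y + c * (2 * k%:~R + 1)).
pose wj (k : int) j :=
  pt (m ^+ j * X + b * (2 * k%:~R + 1)) (n ^+ j * Y + c * (2 * k%:~R + 1)).
have wj0 k : wj k 0%N = w k by rewrite /wj !expr0 !mul1r.
have wjN k : wj k N = w (k + 1).
  by rewrite /wj /w XN YN intrD mulr1z; congr pt; ring.
have mjX j : 0 < m ^+ j * X by rewrite mulr_gt0 // exprn_gt0.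
have njY j : n ^+ j * Y < 0 by rewrite pmulr_rlt0 // exprn_gt0.
have njY' j : - (m - n) <= n ^+ j * Y.
  apply: le_trans Ymn _; rewrite ler_niMl ?(ltW Y0) //.
  by rewrite exprn_ile1 // ltW.
have wjS k j : (j < N)%N -> F (wj k j) = wj k j.+1.
  move=> jN; rewrite /wj !exprS -!(mulrA _ (_ ^+ j)).
  rewrite lift_eigenpt //.
  have := mjX j; have := njY j; have := njY' j; have := Xmn _ jN; lra.
have iterwj k j : (j <= N)%N -> iter j F (w k) = wj k j.
  elim: j => [_|j IH jN]; first by rewrite -wj0.
  by rewrite /= IH ?wjS // ltnW.
have iterN k : iter N F (w k) = w (k + 1) by rewrite iterwj.
have orbw i : exists k j, (j < N)%N /\ iter i F (w 0) = wj k j.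
  elim: i => [|i [k [j [jN wE]]]]; first by exists 0, 0%N; rewrite wj0.
  rewrite /= wE wjS //; case: (ltnP j.+1 N) => jN'; first by exists k, j.+1.
  exists (k + 1), 0%N; split => //; rewrite wj0 -wjN; congr (wj k).
  by apply/eqP; rewrite eqn_leq jN jN'.
have height k j : (j < N)%N -> `|(wj k j).2| <= b + c.
  move=> jN; have -> : (wj k j).2 =
      (c * (m ^+ j * X) - b * (n ^+ j * Y)) / (m - n).
    by rewrite /wj /= -/b -/c; congr (_ / _); ring.
  have cX : 0 <= c * (m ^+ j * X) <= c * (m - n).
    by rewrite mulr_ge0 ?(ltW c0) ?(ltW (mjX j)) // ler_pM2l // ltW // Xmn.
  have bY : 0 <= - (b * (n ^+ j * Y)) <= b * (m - n).
    rewrite -mulrN mulr_ge0 ?oppr_ge0 ?(ltW b0) ?(ltW (njY j)) //.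
    by rewrite ler_pM2l // lerNl njY'.
  rewrite normrM normfV (gtr0_norm mn0) ler_pdivrMr //.
  by rewrite ger0_norm; move: cX bY; lra.
pose p := cyl (w 0).
have cylw k : cyl (w (k + 1)) = cyl (w k).
  rewrite -(shift_cyl (w k) 1) -eigenpt_shift //; congr (cyl (pt _ _));
  by rewrite intrD mulr1z ?/b ?/c; ring.
have fp : iter N f p = p by rewrite /p /f iter_cylmap iterN cylw.
have pA : attractorA lam a p.
  (* On a cycle of length N, going back one step is going forward N - 1. *)
  pose q j := iter (j * N.-1) f p.
  apply: (@bounded_past_attractor _ _ _ lam01 a0 q (b + c)) => j.
    rewrite /q -iterS mulSn addnC -addnS prednK // iterD; congr iter.
    exact: fp.
  rewrite /q /p /f iter_cylmap /cyl.
  by have [k [i [iN ->]]] := orbw (j * N.-1)%N; apply: height.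
exists p; split => //; last first.
  (* One period covers exactly the circumference, so two are needed. *)
  exists (w 0), (N + N)%N; split; first exact: full_orbit_refl.
  rewrite iterD -/F !iterN.
  have -> : w (0 + 1 + 1) = w 0 + (2 * 2%:~R, 0).
    by rewrite -eigenpt_shift // /w !intrD mulr1z mulr0z /b /c; congr pt; ring.
  by rewrite /= addrAC subrr add0r ger0_norm; lra.
move=> q qp; split; first exact: attractor_orbit_annulus pA _ qp.
have [i ->] := full_orbit_periodic f_inj N0 fp qp.
rewrite /p /f iter_cylmap; have [k [j [_ ->]]] := orbw i.
apply: (@above_saddle_notin_paraP _ k); first by rewrite ucoordK // ltrDr.
by rewrite scoordK // gtrDr.
Qed.

End Eigenvalues.

(** * Discontinuity and linearization *)

Lemma cyl_continuous_abscissa (R : realType) (y : R) :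
  continuous (fun t : R => cyl (t, y)).
Proof.
move=> t; have ct : (@circle_of R : R -> circle R) @ t --> circle_of t.
  exact: (@pi_continuous _ {eq_quot (circle_equiv R)}%qT).
have cy : (cst y : R -> R) @ t --> y by exact: cvg_cst.
exact: (cvg_pair ct cy).
Qed.

(** At x = 0 the sawtooth jumps from a to - a.  A point of abscissa d in
]-1, 0[ has g(d) = a (d + 1), so its image differs in height by
lam a (2 + d) > lam a from that of the point with abscissa 0. *)
Lemma cylmap_discontinuous (R : realType) (lam a : R) (p : cylinder R) :
  0 < lam -> 0 < a -> @discontinuity_line R p ->
  ~ {for p, continuous (cylmap lam a)}.
Proof.
move=> l0 a0; case: p => x y; rewrite /discontinuity_line /= => ->.
rewrite -[(circle_of 0, y)]/(cyl (0, y)) => fp.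
have la : 0 < lam * a by rewrite mulr_gt0.
have sndc : (snd : cylinder R -> R) @ (nbhs (cylmap lam a (cyl (0, y)))) -->
    (cylmap lam a (cyl (0, y))).2 by exact: cvg_snd.
have h1 := cvg_comp _ _ (@cyl_continuous_abscissa R y 0) fp.
have := cvg_comp _ _ h1 sndc.
move=> /cvgrPdist_lt/(_ _ la)/nbhs_ballP[e /= e0 eP].
pose d := - Num.min (1 / 2) (e / 2).
have d0 : - 1 < d /\ d < 0.
  rewrite /d; split; first by rewrite ltrN2 gt_min; apply/orP; left; lra.
  by rewrite oppr_lt0 lt_min; apply/andP; split; lra.
have : `|(cylmap lam a (cyl (0, y))).2 - (cylmap lam a (cyl (d, y))).2|
    < lam * a.
  apply: eP.
  rewrite /ball /= sub0r normrN /d normrN ger0_norm.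
    by rewrite gt_min; apply/orP; right; lra.
  by rewrite le_min; apply/andP; split; lra.
rewrite !cylmapE /= (@sawtooth_cell _ a 0 0) ?(@sawtooth_cell _ a d (-1));
  rewrite ?mulr0z ?mulrNz ?mulr1z; [|lra..].
rewrite -mulrBr (normrM lam) (gtr0_norm l0) ltr_pM2l // ltr_norml => /andP[+ _].
nra.
Qed.

(** Off the line, z is in the interior of a cell, on which the lift is
affine. *)
Lemma has_linearization_off_line (R : realType) (lam a : R) (z : R * R) :
  ~ @discontinuity_line R (cyl z) ->
  has_linearization (cylmap lam a) z (linA lam a).
Proof.
move=> zS; have [k /andP[kz zk]] := cell_exists z.1.
have kz' : 2 * k%:~R < z.1.
  rewrite lt_neqAle kz andbT; apply/eqP => zE; apply: zS.
  by apply/circle_ofP; rewrite -zE subr0 mulrC mulKf ?intr_int.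
pose s : R := 2 * k%:~R + 1.
pose fs : {linear (R * R)%type -> R} := fst.
pose sn : {linear (R * R)%type -> R} := snd.
have fd : is_diff z fs fs.
  have fc : continuous fs by move=> x; exact: cvg_fst.
  by apply: DiffDef; [exact: linear_differentiable | exact: diff_lin].
have sd : is_diff z sn sn.
  have sc : continuous sn by move=> x; exact: cvg_snd.
  by apply: DiffDef; [exact: linear_differentiable | exact: diff_lin].
pose g : R * R -> R := (sn : R * R -> R) + a *: ((fs : R * R -> R) - cst s).
pose G w := (((fs : R * R -> R) + g) w, (lam *: g) w).
pose dg : R * R -> R := (sn : R * R -> R) + a *: ((fs : R * R -> R) - 0).
have gd : is_diff z g dg.
  exact: is_diffD sd (is_diffZ a (is_diffB fd (is_diff_cst s z))).
have Gd : is_diff z G (fun h => (((fs : R * R -> R) + dg) h, (lam *: dg) h)).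
  exact: is_diff_pair (is_diffD fd gd) (is_diffZ lam gd).
exists G; split.
- have zc : (fst : R * R -> R) @ z --> z.1 by exact: cvg_fst.
  near=> w; rewrite cylmapE /lift_map (@sawtooth_cell _ a w.1 k).
    by rewrite /G /g /=; congr cyl; congr pair; rewrite -addrA.
  apply/andP; split; first apply: ltW; near: w.
    exact: (cvgr_gt _ zc).
  exact: (cvgr_lt _ zc).
- exact: ex_diff.
move=> h; rewrite (@diff_val _ _ _ _ _ _ _ Gd).
rewrite -[(_, _)]/(h.1 + (h.2 + a * (h.1 - 0)), lam * (h.2 + a * (h.1 - 0))).
apply/matrixP => i j; rewrite !mxE big_ord_recl big_ord1 !mxE.
by case: i => [[|[|//]] ?]; rewrite /=; ring.
Unshelve. all: by end_near.
Qed.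

Lemma linA_eigenvector (R : realType) (lam a mu al : R) :
  1 + a + al = mu -> lam * a + lam * al = mu * al ->
  linA lam a *m colv (1, al) = mu *: colv (1, al).
Proof.
move=> h1 h2; apply/matrixP => i j; rewrite !mxE big_ord_recl big_ord1 !mxE.
by case: i => [[|[|//]] ?]; rewrite /= ?mul1r ?mulr1.
Qed.

Theorem theorem6 (R : realType) (lam a : R)
    (hlam : 0 < lam < 1) (ha : 1 - lam < a) :
  [/\ trapping (cylmap lam a) (annulus lam a),
      singular_hyperbolic (cylmap lam a) (@discontinuity_line R)
        (attractorA lam a) (linA lam a)
        (1, alpha1 lam a) (1, alpha2 lam a),
      attractorA lam a =
        oscillating lam a `|` rotating lam a `|` rotating_oscillating lam a,
      [/\ oscillating lam a !=set0, rotating lam a !=set0 &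
          rotating_oscillating lam a !=set0] /\
      [/\ oscillating lam a `&` rotating lam a = set0,
          oscillating lam a `&` rotating_oscillating lam a = set0 &
          rotating lam a `&` rotating_oscillating lam a = set0] &
      [/\ oscillating lam a `<=` paraP lam a,
          rotating lam a `<=` annulus lam a `\` paraP lam a &
          rotating_oscillating lam a `<=` annulus lam a]].
Proof.
have /andP[l0 l1] := hlam; have l1' : 0 < 1 - lam by rewrite subr_gt0.
have a0 : 0 < a := lt_trans l1' ha.
have self p : full_orbit (cylmap lam a) p p by exact: full_orbit_refl.
have orbitR := attractor_orbit_annulus hlam a0.
have [m [n [m1 n0 n1 lamE aE]]] := eigenvalue_parameters hlam ha.
split.
- exact: annulus_trapping.
- split.
  + by move=> p; exact: cylmap_discontinuous.
  + by subst lam a; exact: attractor_meets_discontinuity.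
  + exact: has_linearization_off_line.
  + by split; apply/eqP => -[/eqP]; rewrite oner_eq0.
  + exists m, n; split; rewrite ?n0 //; subst lam a;
      rewrite ?(alpha1E m1 n1) ?(alpha2E m1 n1); apply: linA_eigenvector; ring.
- apply/seteqP; split => [p pA|p [[[] //|[] //]|[] //]].
  have [inP|/existsNP[q /not_implyP[pq qP]]] :=
      pselect (full_orbit (cylmap lam a) p `<=` paraP lam a).
    by left; left.
  have [[q' [pq' q'P]]|noP] :=
      pselect (full_orbit (cylmap lam a) p `&` paraP lam a !=set0).
    right; split => //; first by exists q'.
    by exists q; split => //; split => //; exact: orbitR pq.
  have outP : full_orbit (cylmap lam a) p `<=` annulus lam a `\` paraP lam a.
    move=> r pr; split; first exact: orbitR pr.
    by move=> rP; apply: noP; exists r.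
  left; right; split => //.
  apply: contrapT => nw; have [_] := outP _ (self p); apply.
  move: nw l1' ha orbitR; subst lam a => nw l1' ha orbitR.
  apply: (nonwinding_in_paraP m1 n0 n1 l1' ha _ nw) => r pr.
  exact/ltW/(orbitR _ pA _ pr).
- split.
    split; subst lam a; [exact: oscillating_nonempty | exact: rotating_nonempty
      | exact: rotating_oscillating_nonempty].
  split; rewrite -subset0 => p [].
  + move=> [_ inP] [_ outP _]; have [_] := outP _ (self p); apply.
    exact: inP.
  + by move=> [_ inP] [_ _ [q [pq [_]]]]; apply; exact: inP.
  + by move=> [_ outP _] [_ [q [pq qP]] _]; have [_] := outP _ pq; apply.
- split=> p.
  + by case=> _; apply.
  + by case=> _ + _; apply.
  + by case=> pA _ _; exact: orbitR pA _ (self p).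
Qed.
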